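(* Let $G_0^*$ be a $(k,r_0)$-regular hypergraph with vertices $v_1,\dots,v_n$, and list the eigenvalues of $S(G_0^* )$ with multiplicity as $\mu_1^{(0)}=n-1-2r_0(k-1),\mu_2^{(0)},\dots,\mu_n^{(0)}$. For $j=1,\dots,n$ let $G_j^*$ be a $(k,r)$-regular hypergraph on $m\ge2$ vertices, and list the eigenvalues of $S(G_j^* )$ with multiplicity as $\mu_1^{(j)}=m-1-2r(k-1),\mu_2^{(j)},\dots,\mu_m^{(j)}$. Let $G^*=G_0^*\odot_1^n G_i^*$ be the generalized corona with $p=1$, $t=n$ and $U_i=\{v_i\}$. Put $b=\binom{m-1}{k-2}$, $c=\binom{m-1}{k-2}-\binom{m-2}{k-2}$ and $h=h(\mu)=-(1+2r(k-1)+2c(m-1)+\mu)$. Then for every real $\mu$, $$P_{S(G^* )}(\mu)=\Big((\mu_1^{(0)}-\mu)(h+mn)+4bm(n-b)-mn^2\Big)\prod_{i=2}^n\Big(\mu_i^{(0)}h-4mb^2-\mu h\Big)\prod_{j=1}^n\prod_{i=2}^m\Big(\mu_i^{(j)}+2c-\mu\Big).$$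
   Context: All hypergraphs are finite and simple: a hypergraph $G^*=(V,E)$ consists of a finite vertex set $V$ and a set $E$ of subsets of $V$ (hyperedges), each of size at least $2$. It is $k$-uniform if every hyperedge has exactly $k$ elements, and $(k,r)$-regular if it is $k$-uniform and every vertex lies in exactly $r$ hyperedges. For a hypergraph with vertices $v_1,\dots,v_n$, the adjacency matrix $A(G^* )$ is the $n\times n$ matrix whose $(i,j)$ entry, for $i\ne j$, is the number of hyperedges containing both $v_i$ and $v_j$, and whose diagonal entries are $0$; the Seidel matrix is $S(G^* )=J_n-I_n-2A(G^* )$, where $J_n$ is the all-ones matrix and $I_n$ the identity. For a square matrix $M$, $P_M(\mu)=\det(M-\mu I)$. Binomial coefficients $\binom{x}{y}$ with integers $x\ge 0$ and $y$ are $0$ when $y<0$ or $y>x$. Generalized corona: let $G_0^*$ be a $k$-uniform hypergraph with vertex set $V_0$, $\{U_1,\dots,U_t\}$ a partition of $V_0$ with $|U_i|=p$, and $G_1^*,\dots,G_t^*$ $k$-uniform hypergraphs. The generalized corona $G_0^*\odot_p^t G_i^*$ is the $k$-uniform hypergraph obtained as follows: for each $i$ take $p$ copies $G_i^{*(1)},\dots,G_i^{*(p)}$ of $G_i^*$, all copies pairwise vertex-disjoint and disjoint from $V_0$. The vertex set is $V_0$ together with the vertices of all copies; the hyperedges are the hyperedges of $G_0^*$, the hyperedges of every copy, and, for every $i\in\{1,\dots,t\}$ and $j\in\{1,\dots,p\}$, every $k$-element subset of $U_i\cup V(G_i^{*(j)})$ that meets both $U_i$ and $V(G_i^{*(j)})$.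 *)

(* Defs.v *)
From HB Require Import structures.
From mathcomp Require Import all_boot all_order all_algebra.
From mathcomp Require Import reals.
Set Implicit Arguments. Unset Strict Implicit. Unset Printing Implicit Defensive.
Import Order.TTheory GRing.Theory Num.Theory.
Local Open Scope ring_scope.

Definition hypergraph (V : finType) (E : {set {set V}}) : Prop :=
  forall e, e \in E -> (2 <= #|e|)%N.

Definition uniform (V : finType) (k : nat) (E : {set {set V}}) : Prop :=
  forall e, e \in E -> #|e| = k.

Definition kr_regular (V : finType) (k r : nat) (E : {set {set V}}) : Prop :=
  [/\ hypergraph E, uniform k E & forall v : V, #|[set e in E | v \in e]| = r].

Definition codeg (V : finType) (E : {set {set V}}) (x y : V) : nat :=
  #|[set e in E | (x \in e) && (y \in e)]|%N.

Definition adjmx (R : nzRingType) (V : finType) (E : {set {set V}}) : 'M[R]_#|V| :=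
  \matrix_(i, j) (if i == j then 0 else (codeg E (enum_val i) (enum_val j))%:R).

Definition seidel (R : nzRingType) (V : finType) (E : {set {set V}}) : 'M[R]_#|V| :=
  const_mx 1 - 1%:M - 2%:R *: adjmx R E.

Definition binz (x : nat) (y : int) : nat :=
  match y with Posz n => 'C(x, n) | Negz _ => 0%N end.

(* Vertex type of the generalized corona G0 (.)_1^n G_i, where G0 lives on 'I_n
   (vertex v_i = i), each G_j lives on 'I_m, and copy j of G_j has vertices
   inr (j, x). *)
Definition corona_vtx (n m : nat) : finType := ('I_n + 'I_n * 'I_m)%type.

(* Hyperedges of the generalized corona with p = 1, t = n, U_i = {v_i}:
   edges of G0, edges of every copy, and every k-subset of U_i u V(G_i^(1))
   meeting both U_i and V(G_i^(1)). *)
Definition corona_edges (n m k : nat) (E0 : {set {set 'I_n}})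
    (Es : 'I_n -> {set {set 'I_m}}) : {set {set corona_vtx n m}} :=
  [set e : {set corona_vtx n m} |
     [exists f in E0, e == [set inl x | x in f] :> {set corona_vtx n m}]
  || [exists j : 'I_n, exists f in Es j,
        e == [set inr (j, x) | x in f] :> {set corona_vtx n m}]
  || [exists i : 'I_n,
        [&& e \subset ((inl i |: [set inr (i, x) | x : 'I_m]) : {set corona_vtx n m}),
            #|e| == k :> nat,
            inl i \in e &
            [exists x : 'I_m, inr (i, x) \in e]]]].

(* Main.v *)
(* Write A = S(G_0) - mu, B = J - 2b and let L be the n x nm incidence matrix of
   vertices against copies. Ordering the vertices of G_0 first, S(G) - mu is the block
   matrix [[A, B L], [L^T B, C]] with C = W + L^T J L, where W is block diagonal with
   blocks M_j = S(G_j) - (mu - 2c) - (2c+1) J, whose row sums are all equal to h. Hence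
   C L^T = L^T D with D = h + m J, and B commutes with D, so multiplying on the right by
   [[D, 0], [-L^T B, 1]] gives det(S(G) - mu) det D = det(A D - m B^2) det C. Each of the
   three remaining determinants is a perturbation by a multiple of J of a matrix whose
   row sums are constant, and these can be read off the spectra of S(G_0) and S(G_j).
   The divisions this requires are valid for all but finitely many mu, and both sides of
   the formula are polynomials in mu. *)
Require Import Defs.
From HB Require Import structures.
From mathcomp Require Import all_boot all_order all_algebra.
From mathcomp Require Import perm reals ring.
Import Order.TTheory GRing.Theory Num.Theory.
Local Open Scope ring_scope.

(** * Determinants of rank-one perturbations and of block matrices *)

(** Sylvester's identity: [[1, -U], [V, 1]] becomes triangular when multiplied on the left by either
    of two unipotent matrices, one clearing V and the other clearing -U. *)
Lemma det1D_mul (K : comNzRingType) p q (U : 'M[K]_(p, q)) (V : 'M[K]_(q, p)) :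
  \det (1%:M + U *m V) = \det (1%:M + V *m U).
Proof.
have E1 : \det (block_mx 1%:M (- U) V 1%:M) = \det (1%:M + V *m U).
  have := det_mulmx (block_mx 1%:M 0 (- V) 1%:M) (block_mx 1%:M (- U) V 1%:M).
  rewrite mulmx_block !mul1mx !mul0mx !mulmx1 addNr !addr0.
  by rewrite det_ublock det_lblock !det1 !mul1r mulNmx mulmxN opprK addrC => <-.
have := det_mulmx (block_mx 1%:M U 0 1%:M) (block_mx 1%:M (- U) V 1%:M).
rewrite mulmx_block !mul1mx !mul0mx !mulmx1 addNr !add0r.
by rewrite det_lblock det_ublock !det1 !mul1r !mulr1 => ->.
Qed.

(** Since u = M (u / s), the factor M splits off from M + u v even when M is singular, and what
    remains is a 1 by 1 determinant. *)
Lemma det_rank1 (K : fieldType) N (M : 'M[K]_N) (u : 'cV_N) (v : 'rV_N) s :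
  s != 0 -> M *m u = s *: u ->
  \det (M + u *m v) * s = \det M * (s + (v *m u) 0 0).
Proof.
move=> s0 Mu.
have -> : M + u *m v = M *m (1%:M + (s^-1 *: u) *m v).
  by rewrite mulmxDr mulmx1 mulmxA -scalemxAr Mu scalerA mulVf ?scale1r.
rewrite det_mulmx det1D_mul det_mx11 !mxE eqxx -mulrA mulrDl mul1r; congr (_ * (_ + _)).
rewrite mulr_suml; apply: eq_bigr => i _.
by rewrite !mxE -mulrA (mulrC (_ * _) s) mulVKf.
Qed.

Lemma det_add_const (K : fieldType) N (M : 'M[K]_N) s a : s != 0 ->
  M *m const_mx 1 = const_mx s :> 'cV_N ->
  \det (M + const_mx a) * s = \det M * (s + a *+ N).
Proof.
move=> s0 M1.
have -> : const_mx a = (const_mx 1 : 'cV_N) *m (const_mx a : 'rV_N).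
  by apply/matrixP=> i j; rewrite !mxE big_ord1 !mxE mul1r.
rewrite det_rank1 //; last by rewrite M1; apply/matrixP=> i j; rewrite !mxE mulr1.
congr (_ * (_ + _)); rewrite !mxE (eq_bigr (fun=> a)) => [|i _]; last by rewrite !mxE mulr1.
by rewrite sumr_const card_ord.
Qed.

(** The multiplier [[D, 0], [-U B, 1]] leaves U B D - C U B = U (B D - D B) = 0 in the lower left
    corner. Keeping [\det D] as a factor avoids inverting D. *)
Lemma det_block_intertwine (K : comNzRingType) p q (A B D : 'M[K]_p)
    (L : 'M_(p, q)) (U : 'M_(q, p)) (C : 'M_q) :
  C *m U = U *m D -> comm_mx B D ->
  \det (block_mx A (B *m L) (U *m B) C) * \det D =
  \det (A *m D - B *m L *m U *m B) * \det C.
Proof.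
move=> CU BD.
have -> : \det D = \det (block_mx D 0 (- (U *m B)) 1%:M) by rewrite det_lblock det1 mulr1.
rewrite -det_mulmx mulmx_block !mulmx1 !mulmx0 !add0r !mulmxN mulmxA mulmxA CU.
by rewrite -!mulmxA BD subrr det_ublock !mulmxA.
Qed.

Lemma det_castmx (K : comNzRingType) p q (e : p = q) (M : 'M[K]_p) :
  \det (castmx (e, e) M) = \det M.
Proof. by case: q / e; rewrite castmx_id. Qed.

Lemma det_mxdiag (K : comNzRingType) n (p_ : 'I_n -> nat) (B_ : forall i, 'M[K]_(p_ i)) :
  \det (\mxdiag_i B_ i) = \prod_i \det (B_ i).
Proof.
elim: n p_ B_ => [|n IH] p_ B_; last first.
  by rewrite mxdiag_recl det_castmx det_ublock IH big_ord_recl.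
(* When n = 0 the size is an empty sum, equal to 0 only up to a rewrite, so the determinant is
   reached through a cast. *)
have det_size0 N (M : 'M[K]_N) : N = 0%N -> \det M = 1.
  by move=> N0; rewrite -(det_castmx _ _ _ N0) det_mx00.
by rewrite [RHS]big_ord0; apply: det_size0; rewrite big_ord0.
Qed.

(** Evaluates the characteristic polynomial at x / a, using a S - x = (-a) (x / a - S). *)
Lemma det_scale_sub_scalar (K : fieldType) N (S : 'M[K]_N) (mu : 'I_N -> K) a x :
  a != 0 -> char_poly S = \prod_i ('X - (mu i)%:P) ->
  \det (a *: S - x%:M) = \prod_i (a * mu i - x).
Proof.
move=> a0 /(congr1 (horner_eval (x / a))).
rewrite /char_poly -det_map_mx /horner_eval horner_prod => E.
have ax : a * (x / a) = x by rewrite mulrCA divff ?mulr1.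
have -> : a *: S - x%:M = (- a) *: map_mx (horner_eval (x / a)) (char_poly_mx S).
  apply/matrixP=> i j; rewrite !mxE /horner_eval !hornerE hornerMn hornerX.
  by rewrite !mulrBr mulrnAr !mulNr ax opprK addrC mulNrn.
rewrite detZ E -[N in _ ^+ N]card_ord -prodr_const -big_split /=; apply: eq_bigr => i _.
by rewrite !hornerE mulrBr !mulNr ax opprK addrC.
Qed.

(** The all-ones vector is an eigenvector, so adding d J shifts its eigenvalue by d N and leaves the
    other factors alone. *)
Lemma det_regular_perturb (K : fieldType) N (S : 'M[K]_N) (mu : 'I_N -> K) i0 a x d :
  a != 0 -> a * mu i0 - x != 0 ->
  char_poly S = \prod_i ('X - (mu i)%:P) ->
  S *m const_mx 1 = const_mx (mu i0) :> 'cV_N ->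
  \det (a *: S - x%:M + const_mx d) =
  (a * mu i0 - x + d *+ N) * \prod_(i | i != i0) (a * mu i - x).
Proof.
move=> a0 s0 HS S1; apply: (mulIf s0); rewrite det_add_const //; last first.
  by rewrite mulmxBl -scalemxAl S1 mul_scalar_mx; apply/matrixP=> i j; rewrite !mxE mulr1.
by rewrite (det_scale_sub_scalar _ _ _ mu) // (bigD1 i0) //= mulrC [RHS]mulrAC -mulrA.
Qed.

(** * Incidence of vertices against copies, and the determinant of the block matrix *)

(** The L of the overview. Its columns stand for pairs (copy, vertex), indexed by the same sum of
    sizes as [\mxdiag], so that the block products apply. *)
Definition corona_incidence (K : pzRingType) n m : 'M[K]_(n, \sum_(i < n) m) :=
  \mxrow_(j < n) \matrix_(i < n, x < m) (i == j)%:R.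

(** Column j of the transpose is the indicator of copy j, on which the block diagonal matrix acts as
    [M j] on the all-ones vector. *)
Lemma corona_incidence_mul_diag (K : comNzRingType) n m (M : 'I_n -> 'M[K]_m) h :
  (forall j, M j *m const_mx 1 = const_mx h :> 'cV_m) ->
  \mxdiag_j M j *m (corona_incidence K n m)^T = h *: (corona_incidence K n m)^T.
Proof.
move=> M1; rewrite tr_mxrow mul_mxdiag_mxcol; apply/matrixP=> s i; rewrite !mxE.
have /matrixP/(_ (tagnat.sig2 s) 0) := M1 (tagnat.sig1 s); rewrite !mxE => <-.
by rewrite mulr_suml; apply: eq_bigr => y _; rewrite !mxE mulr1.
Qed.

Lemma corona_incidence_gram (K : comNzRingType) n m :
  corona_incidence K n m *m (corona_incidence K n m)^T = m%:R%:M.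
Proof.
rewrite tr_mxrow mul_mxrow_mxcol; apply/matrixP=> i i'; rewrite summxE !mxE.
rewrite (bigD1 i) //= big1 ?addr0 => [|j /negPf ji]; rewrite !mxE.
  rewrite (eq_bigr (fun=> (i' == i)%:R)) => [|x _]; last by rewrite !mxE eqxx mul1r.
  by rewrite sumr_const card_ord eq_sym -mulrnA mulnC mulrnA.
by rewrite big1 // => x _; rewrite !mxE eq_sym ji mul0r.
Qed.

Lemma const_mx1_mul (K : pzRingType) p q r :
  (const_mx 1 : 'M[K]_(p, q)) *m (const_mx 1 : 'M_(q, r)) = const_mx q%:R.
Proof.
apply/matrixP=> i j; rewrite !mxE (eq_bigr (fun=> 1)) => [|x _]; last by rewrite !mxE mulr1.
by rewrite sumr_const card_ord.
Qed.

Lemma const_mx1_incidence (K : pzRingType) n m p :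
  (const_mx 1 : 'M[K]_(p, n)) *m corona_incidence K n m = const_mx 1.
Proof.
apply/matrixP=> i s; rewrite !mxE (bigD1 (tagnat.sig1 s)) //= !mxE eqxx mulr1.
by rewrite big1 ?addr0 // => j /negPf jP; rewrite !mxE jP mulr0.
Qed.

(* Here [e] and [f] stand for 2c and 2b, and [s] is the common row sum of the S(G_j). *)
Lemma det_corona_block (K : fieldType) n m (S0 : 'M[K]_n) (S : 'I_n -> 'M[K]_m)
    (mu0 : 'I_n -> K) (mus : 'I_n -> 'I_m -> K) i0 j0 s e f mu :
  let L := corona_incidence K n m in
  let B : 'M[K]_n := const_mx 1 - f%:M in
  let h := s - m%:R - e * (m%:R - 1) - mu in
  S0^T = S0 -> S0 *m const_mx 1 = const_mx (mu0 i0) :> 'cV_n ->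
  (forall j, S j *m const_mx 1 = const_mx s :> 'cV_m) ->
  (forall j, mus j j0 = s) ->
  char_poly S0 = \prod_i ('X - (mu0 i)%:P) ->
  (forall j, char_poly (S j) = \prod_i ('X - (mus j i)%:P)) ->
  h != 0 -> h + m%:R * n%:R != 0 -> s + e - mu != 0 ->
  h * mu0 i0 - (mu * h + m%:R * f ^+ 2) != 0 ->
  \det (block_mx (S0 - mu%:M) (B *m L) (L^T *m B)
          (\mxdiag_j (S j - (mu - e)%:M - const_mx (e + 1)) + const_mx 1)) =
  ((mu0 i0 - mu) * (h + m%:R * n%:R) - m%:R * (n%:R - f) ^+ 2)
  * (\prod_(i | i != i0) (h * mu0 i - (mu * h + m%:R * f ^+ 2)))
  * \prod_j \prod_(i | i != j0) (mus j i + e - mu).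
Proof.
move=> L B h S0T S01 S1 musj hS0 hS h0 hmn0 se0 hmu0.
pose D : 'M[K]_n := h%:M + const_mx m%:R.
have JS0 : (const_mx 1 : 'rV_n) *m S0 = const_mx (mu0 i0).
  by apply: trmx_inj; rewrite trmx_mul S0T !trmx_const.
have M1 j : (S j - (mu - e)%:M - const_mx (e + 1)) *m const_mx 1 = const_mx h :> 'cV_m.
  rewrite !mulmxBl S1 mul_scalar_mx.
  have -> : const_mx (e + 1) = (e + 1) *: const_mx 1 :> 'M[K]_m.
    by apply/matrixP=> x y; rewrite !mxE mulr1.
  rewrite -scalemxAl const_mx1_mul; apply/matrixP=> x y; rewrite !mxE /h; ring.
(* Subtracting (e + 1) J moves the eigenvalue s + e - mu of the all-ones vector to s + e - mu - (e +
   1) m = h. *)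
have detM j : \det (S j - (mu - e)%:M - const_mx (e + 1)) =
    h * \prod_(i | i != j0) (mus j i + e - mu).
  have -> : S j - (mu - e)%:M - const_mx (e + 1) =
      1 *: S j - (mu - e)%:M + const_mx (- (e + 1)).
    by rewrite scale1r; congr (_ + _); apply/matrixP=> x y; rewrite !mxE.
  have E i : 1 * mus j i - (mu - e) = mus j i + e - mu by ring.
  rewrite (det_regular_perturb _ _ _ (mus j) j0) ?oner_neq0 ?E ?musj //.
  under eq_bigr do rewrite E.
  by congr (_ * _); rewrite -mulr_natr /h; ring.
set W := mxdiag _; set C := W + _.
have WL : W *m L^T = h *: L^T by apply: corona_incidence_mul_diag.
have CL : C *m L^T = L^T *m D.
  rewrite mulmxDl WL /D mulmxDr mul_mx_scalar; congr (_ + _).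
  (* The square all-ones matrix is L^T J L, and L L^T = m, so its product with L^T is L^T (m J). *)
  have -> : const_mx 1 = L^T *m const_mx 1 :> 'M_(\sum_(i < n) m).
    apply: trmx_inj; rewrite trmx_mul trmxK !trmx_const.
    by rewrite const_mx1_incidence.
  have -> : const_mx 1 = (const_mx 1 : 'M[K]_n) *m L :> 'M_(n, \sum_(i < n) m).
    by rewrite const_mx1_incidence.
  rewrite -!mulmxA corona_incidence_gram mul_mx_scalar; congr (_ *m _).
  by apply/matrixP=> x y; rewrite !mxE mulr1.
have constE p q a : const_mx a = a *: const_mx 1 :> 'M[K]_(p, q).
  by apply/matrixP=> x y; rewrite !mxE mulr1.
have BD : comm_mx B D.
  rewrite /B /D (constE _ _ m%:R).
  apply: comm_mxD; first exact: comm_mx_scalar.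
  apply/comm_mx_sym/comm_mxB; last exact: comm_mx_scalar.
  by rewrite /comm_mx -scalemxAl -scalemxAr.
have JL : const_mx 1 = L^T *m const_mx 1 :> 'cV_(\sum_(i < n) m).
  by apply: trmx_inj; rewrite trmx_mul trmxK !trmx_const const_mx1_incidence.
have detD : \det D * h = h ^+ n * (h + m%:R * n%:R).
  rewrite det_add_const ?det_scalar ?mulr_natr // mul_scalar_mx.
  by apply/matrixP=> x y; rewrite !mxE mulr1.
have detC : \det C * h = \det W * (h + m%:R * n%:R).
  rewrite det_add_const //; last first.
    by rewrite JL mulmxA WL -scalemxAl -JL; apply/matrixP=> x y; rewrite !mxE mulr1.
  have -> // : 1 *+ (\sum_(i < n) m) = m%:R * n%:R :> K.
  by rewrite sum_nat_const card_ord mulnC natrM.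
have detW : \det W = h ^+ n * \prod_j \prod_(i | i != j0) (mus j i + e - mu).
  rewrite det_mxdiag (eq_bigr _ (fun j _ => detM j)) big_split /=.
  by rewrite prodr_const card_ord.
have detAD : \det ((S0 - mu%:M) *m D - B *m L *m L^T *m B) =
  ((mu0 i0 - mu) * (h + m%:R * n%:R) - m%:R * (n%:R - f) ^+ 2)
  * (\prod_(i | i != i0) (h * mu0 i - (mu * h + m%:R * f ^+ 2))).
  (* Everything lies in the span of S0, 1 and J: S0 J = mu0(i0) J and B^2 = (n - 2f) J + f^2. *)
  have -> : (S0 - mu%:M) *m D - B *m L *m L^T *m B =
      h *: S0 - (mu * h + m%:R * f ^+ 2)%:M +
      const_mx (m%:R * (mu0 i0 - mu) - m%:R * n%:R + 2 * m%:R * f).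
    have S0J : S0 *m (const_mx 1 : 'M_n) = const_mx (mu0 i0).
      rewrite -[const_mx 1](_ : (const_mx 1 : 'cV_n) *m (const_mx 1 : 'rV_n) = _).
        by rewrite mulmxA S01; apply/matrixP=> x y; rewrite !mxE big_ord1 !mxE mulr1.
      by rewrite const_mx1_mul.
    rewrite -[_ *m L *m _]mulmxA corona_incidence_gram mul_mx_scalar -scalemxAl.
    rewrite /D /B (constE _ _ m%:R) !(mulmxDr, mulmxDl, mulmxN, mulNmx).
    rewrite -!scalemxAr !mul_mx_scalar !mul_scalar_mx S0J const_mx1_mul.
    apply/matrixP=> x y; rewrite !mxE; case: (x == y); rewrite ?mulr1n ?mulr0n; ring.
  rewrite (det_regular_perturb _ _ _ mu0 i0) //; congr (_ * _).
  by rewrite -mulr_natr; ring.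
have := det_block_intertwine _ _ _ (S0 - mu%:M) B D L L^T C CL BD.
(* After multiplication by h both sides carry the nonzero factor h^n (h + m n): on the left from det
   D, on the right from det C and det W. *)
rewrite detAD => /(congr1 (fun x => x * h)) /eqP.
rewrite -[X in X == _]mulrA detD -[X in _ == X]mulrA detC detW => /eqP E.
have hn0 : h ^+ n * (h + m%:R * n%:R) != 0 by rewrite mulf_neq0 ?expf_neq0.
by apply: (mulIf hn0); rewrite E; ring.
Qed.

(** * Codegrees in regular hypergraphs, and a count of sets *)

Lemma codegC (V : finType) (E : {set {set V}}) x y : codeg E x y = codeg E y x.
Proof. by apply: eq_card => e; rewrite !inE [(x \in e) && _]andbC. Qed.

Lemma codegxx (V : finType) (k r : nat) (E : {set {set V}}) x :
  kr_regular k r E -> codeg E x x = r.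
Proof. by case=> _ _ /(_ x) <-; apply: eq_card => e; rewrite !inE andbb. Qed.

(** Double counting of the pairs (y, e) with x and y in e. The term y = x is included, hence k and
    not k - 1. *)
Lemma sum_codeg (V : finType) (k r : nat) (E : {set {set V}}) x :
  kr_regular k r E -> (\sum_y codeg E x y = r * k)%N.
Proof.
case=> _ kE /(_ x) <-; rewrite /codeg -sum_nat_const.
under eq_bigr do rewrite -sum1_card.
rewrite (exchange_big_dep (mem [set e in E | x \in e])) /=; last first.
  by move=> y e _; rewrite !inE => /and3P[-> ->].
apply: eq_bigr => e; rewrite inE => /andP[eE xe].
by rewrite -(kE e eE) -sum1_card; apply: eq_bigl => y; rewrite inE eE xe.
Qed.

(** Removing A gives a bijection onto the (k - |A|)-subsets of B minus A. The test guards against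
    truncated subtraction, which would yield 1 for k < |A|. *)
Lemma card_sets_between (T : finType) (A B : {set T}) (k : nat) : A \subset B ->
  #|[set e : {set T} | [&& A \subset e, e \subset B & #|e| == k]]| =
  if (#|A| <= k)%N then 'C(#|B| - #|A|, k - #|A|) else 0%N.
Proof.
move=> AB; case: leqP => Ak; last first.
  apply: eq_card0 => e; rewrite !inE; apply/negP => /and3P[/subset_leq_card Ae _ /eqP ek].
  by move: Ae; rewrite ek leqNgt Ak.
rewrite -(cardsDS AB) -cards_draws.
rewrite -[RHS](card_in_imset (f := fun e => A :|: e)) => [|e e']; last first.
  rewrite !inE => /andP[eB _] /andP[e'B _] /(congr1 (fun X => X :\: A)).
  have disj (X : {set T}) : X \subset B :\: A -> (A :|: X) :\: A = X.
    by rewrite subsetD setDUl setDv set0U => /andP[_ /setDidPl->].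
  by rewrite !disj.
apply: eq_card => e; rewrite !inE; apply/and3P/imsetP.
  case=> Ae eB /eqP ek; exists (e :\: A); first by rewrite inE setSD //= cardsDS // ek.
  by rewrite -{1}(setIidPr Ae) setID.
case=> f; rewrite inE subsetD => /andP[/andP[fB fA] /eqP fk] ->.
rewrite subsetUl subUset AB fB; split=> //.
by rewrite cardsU disjoint_setI0 1?disjoint_sym // cards0 subn0 fk subnKC.
Qed.

Lemma corona_edgeP (n m k : nat) (E0 : {set {set 'I_n}}) (Es : 'I_n -> {set {set 'I_m}})
    (e : {set corona_vtx n m}) :
  reflect [\/ exists2 f, f \in E0 & e = [set inl x | x in f],
             exists j, exists2 f, f \in Es j & e = [set inr (j, x) | x in f]
           | exists i x, [/\ e \subset inl i |: [set inr (i, x) | x : 'I_m],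
                             #|e| = k, inl i \in e & inr (i, x) \in e]]
          (e \in corona_edges k E0 Es).
Proof.
rewrite inE -orbA; apply: (iffP or3P).
  case=> [/exists_inP[f fE /eqP ->]|/existsP[j /exists_inP[f fE /eqP ->]]|].
  - by constructor 1; exists f.
  - by constructor 2; exists j, f.
  case/existsP=> i /and4P[eB /eqP ek ie /existsP[x xe]].
  by constructor 3; exists i, x.
case=> [[f fE ->]|[j [f fE ->]]|[i [x [eB ek ie xe]]]].
- by constructor 1; apply/exists_inP; exists f.
- by constructor 2; apply/existsP; exists j; apply/exists_inP; exists f.
- constructor 3; apply/existsP; exists i; rewrite eB ek eqxx ie /=.
  by apply/existsP; exists x.
Qed.

Lemma inr_pair_inj (A B C : Type) (b : B) : injective (fun x : C => inr (b, x) : A + B * C).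
Proof. by move=> x y []. Qed.

(** * Codegrees in the corona *)

Section Codegree.
Variables (n m k : nat) (E0 : {set {set 'I_n}}) (Es : 'I_n -> {set {set 'I_m}}).
Local Notation E := (corona_edges k E0 Es).
Local Notation block i := (inl i |: [set inr (i, x) | x : 'I_m] : {set corona_vtx n m}).

Lemma mem_block_inl i j : (inl j \in block i) = (j == i).
Proof.
rewrite !inE (inj_eq (@inl_inj _ _)) orbC.
by case: imsetP => // -[].
Qed.

Lemma mem_block_inr i j x : (inr (j, x) \in block i) = (j == i).
Proof.
rewrite !inE /=; apply/imsetP/eqP => [[y _ [->]] //|->]; by exists x.
Qed.

Lemma card_block i : #|block i| = m.+1.
Proof.
rewrite cardsU1 card_imset; last exact: inr_pair_inj.
by rewrite card_ord; case: imsetP => // -[].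
Qed.

Lemma inl_imset_inl (f : {set 'I_n}) i :
  (inl i \in ([set inl x | x in f] : {set corona_vtx n m})) = (i \in f).
Proof. by rewrite mem_imset //; apply: inl_inj. Qed.

Lemma inr_imset_inl (f : {set 'I_n}) p :
  (inr p \in ([set inl x | x in f] : {set corona_vtx n m})) = false.
Proof. by apply/imsetP=> -[]. Qed.

Lemma inl_imset_inr j (f : {set 'I_m}) i :
  (inl i \in ([set inr (j, x) | x in f] : {set corona_vtx n m})) = false.
Proof. by apply/imsetP=> -[]. Qed.

Lemma inr_imset_inr j (f : {set 'I_m}) i x :
  (inr (i, x) \in ([set inr (j, x) | x in f] : {set corona_vtx n m})) = (i == j) && (x \in f).
Proof.
apply/imsetP/andP => [[y yf [-> ->]]|[/eqP-> xf]]; first by rewrite eqxx.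
by exists x.
Qed.

Lemma codeg_corona_inl i j : i != j -> codeg E (inl i) (inl j) = codeg E0 i j.
Proof.
move=> ij; rewrite /codeg -[RHS](card_imset _ (imset_inj (@inl_inj _ ('I_n * 'I_m)%type))).
apply: eq_card => e; apply/setIdP/imsetP.
  case=> /corona_edgeP[[f fE ->]|[j' [f fE ->]]|[i' [x [eB _ _ _]]]]; rewrite ?inl_imset_inr //.
    by rewrite !inl_imset_inl => ijf; exists f => //; rewrite inE fE.
  case/andP=> /(subsetP eB); rewrite mem_block_inl => /eqP ii' /(subsetP eB).
  by rewrite mem_block_inl -ii' eq_sym (negPf ij).
case=> f /setIdP[fE ijf] ->; rewrite !inl_imset_inl; split=> //.
by apply/corona_edgeP; constructor 1; exists f.
Qed.

(** Only the joining edges contain both vertices: they are the k-sets between this pair and a block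
    of m + 1 vertices. This count is the b of the theorem. *)
Lemma codeg_corona_inl_inr i j x :
  codeg E (inl i) (inr (j, x)) =
  if (i == j) && (2 <= k)%N then 'C(m.-1, k - 2) else 0%N.
Proof.
case: eqVneq => [<-|ij] /=; last first.
  apply: eq_card0 => e; rewrite inE; apply/negP => /andP[/corona_edgeP].
  case=> [[f fE ->]|[j' [f fE ->]]|[i' [y [eB _ _ _]]]].
  - by rewrite inr_imset_inl andbF.
  - by rewrite inl_imset_inr.
  case/andP=> /(subsetP eB); rewrite mem_block_inl => /eqP ii' /(subsetP eB).
  by rewrite mem_block_inr -ii' eq_sym (negPf ij).
have -> : m.-1 = (#|block i| - 2)%N by rewrite card_block subSS subn1.
have c2 : #|[set inl i; inr (i, x)] : {set corona_vtx n m}| = 2%N by rewrite cards2.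
rewrite -c2 -card_sets_between; last first.
  by rewrite subUset !sub1set mem_block_inl mem_block_inr !eqxx.
apply: eq_card => e; rewrite [RHS]inE subUset !sub1set; apply/setIdP/and3P.
  case=> /corona_edgeP[[f fE ->]|[j' [f fE ->]]|[i' [y [eB ek _ _]]]].
  - by rewrite inr_imset_inl andbF.
  - by rewrite inl_imset_inr.
  case/andP=> ie xe; rewrite ie xe ek eqxx; split=> //.
  by have := subsetP eB _ ie; rewrite mem_block_inl => /eqP->.
case=> /andP[ie xe] eB /eqP ek; split; last by rewrite ie.
by apply/corona_edgeP; constructor 3; exists i, x.
Qed.

Lemma codeg_corona_inr_neq i j x y : i != j -> codeg E (inr (i, x)) (inr (j, y)) = 0%N.
Proof.
move=> ij; apply: eq_card0 => e; rewrite inE; apply/negP => /andP[/corona_edgeP].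
case=> [[f fE ->]|[j' [f fE ->]]|[i' [z [eB _ _ _]]]].
- by rewrite inr_imset_inl.
- rewrite !inr_imset_inr => /andP[/andP[/eqP <- _] /andP[]].
  by rewrite eq_sym (negPf ij).
case/andP=> /(subsetP eB); rewrite mem_block_inr => /eqP ii' /(subsetP eB).
by rewrite mem_block_inr -ii' eq_sym (negPf ij).
Qed.

(** A joining edge through x and y also contains [inl i], so it is a k-set between a triple and the
    block. For the same reason these edges are disjoint from those of the copy. *)
Lemma codeg_corona_inr i x y : x != y ->
  codeg E (inr (i, x)) (inr (i, y)) =
  (codeg (Es i) x y + if (3 <= k)%N then 'C(m - 2, k - 3) else 0)%N.
Proof.
move=> xy.
have -> : (m - 2 = #|block i| - 3)%N by rewrite card_block subSS.
pose A : {set corona_vtx n m} := [set inl i; inr (i, x); inr (i, y)].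
have c3 : #|A| = 3%N.
  rewrite /A setUC cardsU1 cards2 !inE /=.
  by rewrite (inj_eq (inr_pair_inj _ _ _ _)) eq_sym (negPf xy).
rewrite -c3 -card_sets_between; last first.
  by rewrite !subUset !sub1set mem_block_inl !mem_block_inr !eqxx.
rewrite /codeg -(card_imset _ (imset_inj (inr_pair_inj 'I_n 'I_n 'I_m i))).
rewrite -cardsUI (_ : _ :&: _ = set0) ?cards0 ?addn0; last first.
  apply/setP=> e; rewrite !inE; apply/negP => /andP[/imsetP[f _ ->]].
  by rewrite !subUset !sub1set inl_imset_inr.
apply: eq_card => e; apply/setIdP/setUP.
  case=> /corona_edgeP[[f fE ->]|[j' [f fE ->]]|[i' [z [eB ek ie _]]]].
  - by rewrite inr_imset_inl.
  - rewrite !inr_imset_inr => /andP[/andP[/eqP ii' xf] /andP[_ yf]].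
    rewrite -ii' in fE *; left; apply/imsetP; exists f => //.
    by rewrite inE fE xf yf.
  case/andP=> xe ye; right; rewrite inE ek eqxx andbT.
  have := subsetP eB _ xe; rewrite mem_block_inr => /eqP ii'.
  by move: eB ie; rewrite -ii' !subUset !sub1set => -> ->; rewrite xe ye.
case=> [/imsetP[f /setIdP[fE /andP[xf yf]] ->]|].
  rewrite !inr_imset_inr eqxx xf yf; split=> //.
  by apply/corona_edgeP; constructor 2; exists i, f.
rewrite inE !subUset !sub1set => /and3P[/andP[/andP[ie xe] ye] eB /eqP ek].
rewrite xe ye; split=> //; apply/corona_edgeP; constructor 3; by exists i, x.
Qed.

End Codegree.

(** * Seidel matrices under a change of indexing *)

(** Indexed by vertices instead of their enumeration ranks, so that the vertices can be listed in
    any convenient order. *)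
Definition seidel_entry (R : nzRingType) (V : finType) (E : {set {set V}}) (x y : V) : R :=
  1 - (x == y)%:R - 2 * (if x == y then 0 else (codeg E x y)%:R).

Lemma seidel_entryC (R : nzRingType) (V : finType) (E : {set {set V}}) (x y : V) :
  seidel_entry R V E x y = seidel_entry R V E y x.
Proof. by rewrite /seidel_entry eq_sym codegC. Qed.

Lemma seidelE (R : nzRingType) (V : finType) (E : {set {set V}}) :
  seidel R E = \matrix_(i, j) seidel_entry R V E (enum_val i) (enum_val j).
Proof. by apply/matrixP=> i j; rewrite !mxE /seidel_entry (inj_eq enum_val_inj). Qed.

Lemma sum_seidel_entry (R : nzRingType) (V : finType) (k r : nat) (E : {set {set V}}) x :
  kr_regular k r E ->
  \sum_y seidel_entry R V E x y = #|V|%:R - 1 - 2 * r%:R * (k%:R - 1).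
Proof.
move=> rE; rewrite !sumrB sumr_const -mulr_sumr; congr (_ - _ - _).
  rewrite (bigD1 x) //= eqxx big1 ?addr0 // => y /negPf; rewrite eq_sym => -> //.
have := sum_codeg V k r E x rE; rewrite (bigD1 x) //= (codegxx V k r) // => rk.
have rkE : r%:R * (k%:R - 1) = \sum_(y | y != x) (codeg E x y)%:R :> R.
  by rewrite mulrBr mulr1 -natrM -rk natrD natr_sum addrC addKr.
rewrite -mulrA rkE (bigD1 x) //= eqxx add0r; congr (_ * _); apply: eq_bigr => y.
by rewrite eq_sym => /negPf->.
Qed.

(** Two listings of V differ by a permutation, which acts on rows and columns alike, so its sign
    occurs twice. *)
Lemma det_reindex (K : comNzRingType) (V : finType) N (F : V -> V -> K) (f : 'I_N -> V) :
  bijective f ->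
  \det (\matrix_(i < #|V|, j < #|V|) F (enum_val i) (enum_val j)) =
  \det (\matrix_(i, j) F (f i) (f j)).
Proof.
move=> bf; have := bij_eq_card bf; rewrite card_ord => e; subst N.
have si : injective (fun i => enum_rank (f i)).
  by move=> i j /enum_rank_inj; apply: bij_inj.
have -> : \matrix_(i, j) F (f i) (f j) =
    row_perm (perm si) (col_perm (perm si) (\matrix_(i, j) F (enum_val i) (enum_val j))).
  by apply/matrixP=> i j; rewrite !mxE !permE !enum_rankK.
rewrite row_permE col_permE !det_mulmx !det_perm odd_permV.
by rewrite mulrC -mulrA -signr_addb addbb mulr1.
Qed.

Lemma det_seidel_sub_scalar (R : comNzRingType) (V : finType) N (E : {set {set V}})
    (f : 'I_N -> V) a :
  bijective f ->
  \det (seidel R E - a%:M) = \det (\matrix_(i, j) seidel_entry R V E (f i) (f j) - a%:M).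
Proof.
move=> bf; pose F x y := seidel_entry R V E x y - (x == y)%:R * a.
have -> : seidel R E - a%:M = \matrix_(i, j) F (enum_val i) (enum_val j).
  by rewrite seidelE; apply/matrixP=> i j; rewrite !mxE /F (inj_eq enum_val_inj) mulr_natl.
rewrite (det_reindex _ _ _ _ f) //; congr (\det _); apply/matrixP=> i j.
by rewrite !mxE /F (inj_eq (bij_inj bf)) mulr_natl.
Qed.

Lemma char_poly_seidel (R : comNzRingType) (V : finType) N (E : {set {set V}})
    (f : 'I_N -> V) :
  bijective f ->
  char_poly (seidel R E) = char_poly (\matrix_(i, j) seidel_entry R V E (f i) (f j)).
Proof.
move=> bf; pose F x y := 'X *+ (x == y) - (seidel_entry R V E x y)%:P.
rewrite /char_poly (_ : char_poly_mx _ = \matrix_(i, j) F (enum_val i) (enum_val j)).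
  rewrite (det_reindex _ _ _ _ f) //; congr (\det _); apply/matrixP=> i j.
  by rewrite !mxE /F (inj_eq (bij_inj bf)).
by rewrite seidelE; apply/matrixP=> i j; rewrite !mxE /F (inj_eq enum_val_inj).
Qed.

(** (P - Q) D vanishes at every point, hence at more distinct natural numbers than its degree. *)
Lemma poly_eq_generic (R : numDomainType) (P Q D : {poly R}) :
  D != 0 -> (forall x, D.[x] != 0 -> P.[x] = Q.[x]) -> P = Q.
Proof.
move=> D0 PQ; suff /eqP : (P - Q) * D = 0.
  by rewrite mulf_eq0 (negPf D0) orbF subr_eq0 => /eqP.
apply: (@roots_geq_poly_eq0 _ _ [seq i%:R | i <- iota 0 (size ((P - Q) * D))]).
- apply/allP=> x _; rewrite rootE hornerM mulf_eq0 orbC.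
  by case: eqVneq => //= Dx; rewrite hornerD hornerN PQ ?subrr.
- rewrite map_inj_uniq ?iota_uniq // => i j /eqP.
  by rewrite eqr_nat => /eqP.
- by rewrite size_map size_iota.
Qed.

(** * Block form of the Seidel matrix of the corona *)

Section CoronaMatrix.
Variables (n m : nat).

(** Lists the vertices of G_0 first and then the copies one after another, in the column order of
    [corona_incidence]. *)
Definition corona_index (s : 'I_(n + \sum_(i < n) m)) : corona_vtx n m :=
  match split s with
  | inl i => inl i
  | inr t => inr (tagnat.sig1 t, tagnat.sig2 t)
  end.

Lemma corona_index_bij : bijective corona_index.
Proof.
pose g (v : corona_vtx n m) : 'I_(n + \sum_(i < n) m) :=
  match v with inl i => lshift _ i | inr p => rshift _ (@tagnat.Rank _ (fun=> m) p.1 p.2) end.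
apply: (@inj_card_bij _ _ corona_index).
  apply: (can_inj (g := g)) => s; rewrite /corona_index -[RHS]splitK.
  by case: split => //= t; rewrite tagnat.sig2K.
by rewrite card_sum card_prod !card_ord sum_nat_const card_ord.
Qed.

Lemma corona_index_lshift i : corona_index (lshift _ i) = inl i.
Proof. by rewrite /corona_index (unsplitK (inl i)). Qed.

Lemma corona_index_rshift t :
  corona_index (rshift _ t) = inr (tagnat.sig1 t, tagnat.sig2 t).
Proof. by rewrite /corona_index (unsplitK (inr t)). Qed.

End CoronaMatrix.

(** A copy meets itself in S_j - mu - e (J - 1) and any other copy in J. Adding J globally accounts
    for the latter, and the 1 in e + 1 compensates for it inside each copy. *)
Lemma corona_seidel_block (R : comNzRingType) (n m k : nat) (E0 : {set {set 'I_n}})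
    (Es : 'I_n -> {set {set 'I_m}}) (mu : R) :
  let f : R := 2 * (if (2 <= k)%N then 'C(m.-1, k - 2) else 0%N)%:R in
  let e : R := 2 * (if (3 <= k)%N then 'C(m - 2, k - 3) else 0%N)%:R in
  let B : 'M[R]_n := const_mx 1 - f%:M in
  let L := corona_incidence R n m in
  \matrix_(s, t) seidel_entry R _ (corona_edges k E0 Es) (corona_index n m s) (corona_index n m t)
    - mu%:M =
  block_mx (\matrix_(i, j) seidel_entry R _ E0 i j - mu%:M) (B *m L) (L^T *m B)
    (\mxdiag_j (\matrix_(x, y) seidel_entry R _ (Es j) x y - (mu - e)%:M - const_mx (e + 1))
       + const_mx 1).
Proof.
move=> f e B L.
have BL i t : (B *m L) i t = 1 - f *+ (i == tagnat.sig1 t).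
  rewrite mxE (bigD1 (tagnat.sig1 t)) //= [X in _ + X]big1 ?addr0 => [|j /negPf jt];
    rewrite !mxE ?eqxx ?mulr1 //.
  by rewrite jt mulr0.
have -> : L^T *m B = (B *m L)^T.
  by rewrite trmx_mul; congr (_ *m _); apply/matrixP=> i j; rewrite !mxE eq_sym.
have entry_inl_inr i t : seidel_entry R _ (corona_edges k E0 Es) (inl i)
    (inr (tagnat.sig1 t, tagnat.sig2 t)) = 1 - f *+ (i == tagnat.sig1 t).
  rewrite /seidel_entry /= codeg_corona_inl_inr subr0 /f.
  by case: eqVneq => _ /=; rewrite ?mulr0.
rewrite -[LHS]submxK; congr block_mx; apply/matrixP=> s t.
- rewrite !mxE !corona_index_lshift (inj_eq (@lshift_inj _ _)) /seidel_entry.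
  rewrite (inj_eq (@inl_inj _ _)); case: eqVneq => // st.
  by rewrite codeg_corona_inl.
- by rewrite BL !mxE corona_index_lshift corona_index_rshift entry_inl_inr eq_lrshift subr0.
- rewrite [RHS]mxE BL !mxE corona_index_lshift corona_index_rshift seidel_entryC.
  by rewrite entry_inl_inr eq_rlshift subr0.
rewrite !mxE -(inj_eq (bij_inj (corona_index_bij n m))) !corona_index_rshift.
rewrite /seidel_entry (inj_eq (@inr_inj _ _)) xpair_eqE.
case: eqVneq => /= [st|st]; last by rewrite codeg_corona_inr_neq // !mxE; ring.
rewrite conform_mx_id !mxE -st; case: eqVneq => /= [_|xy]; rewrite ?mulr1n; first ring.
rewrite codeg_corona_inr // natrD /e; ring.
Qed.

(** * The binomial parameters and the proof for every mu *)

Lemma binz_sub2 x k : binz x (k%:Z - 2) = if (2 <= k)%N then 'C(x, k - 2) else 0%N.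
Proof. by case: k => [|[|k]] //=; rewrite -subzn. Qed.

(** Pascal's rule. It identifies the c of the theorem with the number of joining edges through two
    given vertices of a copy. *)
Lemma binz_pascal m k : (2 <= m)%N ->
  binz m.-1 (k%:Z - 2) =
  (binz (m - 2) (k%:Z - 2) + if (3 <= k)%N then 'C(m - 2, k - 3) else 0)%N.
Proof.
case: m => [|[|m]] // _; rewrite !binz_sub2 /= !subSS subn0.
by case: k => [|[|[|k]]] //=; rewrite ?bin0 // !subSS !subn0 binS.
Qed.

Lemma quadratic_neq0 (R : idomainType) (a b c : R) :
  ('X - a%:P) * ('X - b%:P) - c%:P != 0.
Proof.
rewrite -size_poly_eq0 size_polyDl.
  by rewrite size_mul ?polyXsubC_eq0 // !size_XsubC.
rewrite size_polyN size_mul ?polyXsubC_eq0 // !size_XsubC.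
exact: leq_ltn_trans (size_polyC_leq1 _) _.
Qed.

Lemma seidel_matrix_sum (R : nzRingType) (N k r : nat) (E : {set {set 'I_N}}) :
  kr_regular k r E ->
  \matrix_(i, j) seidel_entry R _ E i j *m const_mx 1 =
  const_mx (N%:R - 1 - 2 * r%:R * (k%:R - 1)) :> 'cV_N.
Proof.
move=> rE; apply/matrixP=> i j; rewrite !mxE.
rewrite -[in RHS](card_ord N) -(sum_seidel_entry _ _ _ _ E i rE).
by apply: eq_bigr => y _; rewrite !mxE mulr1.
Qed.

Theorem theorem3p4 (R : realType) (n m k r0 r : nat)
  (E0 : {set {set 'I_n}}) (Es : 'I_n -> {set {set 'I_m}})
  (mu0 : 'I_n -> R) (mus : 'I_n -> 'I_m -> R)
  (n_gt0 : (0 < n)%N) (m_ge2 : (2 <= m)%N)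
  (hG0 : kr_regular k r0 E0)
  (hGj : forall j, kr_regular k r (Es j))
  (hmu0 : char_poly (seidel R E0) = \prod_(i < n) ('X - (mu0 i)%:P))
  (hmu01 : mu0 (Ordinal n_gt0) = n%:R - 1 - 2 * r0%:R * (k%:R - 1))
  (hmus : forall j, char_poly (seidel R (Es j)) = \prod_(i < m) ('X - (mus j i)%:P))
  (hmus1 : forall j, mus j (Ordinal (ltnW m_ge2)) = m%:R - 1 - 2 * r%:R * (k%:R - 1)) :
  let b : R := (binz m.-1 (k%:Z - 2))%:R in
  let c : R := (binz m.-1 (k%:Z - 2))%:R - (binz (m - 2) (k%:Z - 2))%:R in
  let h (mu : R) : R := - (1 + 2 * r%:R * (k%:R - 1) + 2 * c * (m%:R - 1) + mu) in
  forall mu : R,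
    \det (seidel R (corona_edges k E0 Es) - mu%:M) =
      ((mu0 (Ordinal n_gt0) - mu) * (h mu + m%:R * n%:R)
         + 4 * b * m%:R * (n%:R - b) - m%:R * n%:R ^+ 2)
      * (\prod_(i < n | (0 < i)%N) (mu0 i * h mu - 4 * m%:R * b ^+ 2 - mu * h mu))
      * (\prod_(j < n) \prod_(i < m | (0 < i)%N) (mus j i + 2 * c - mu)).
Proof.
move=> b c h mu; set i0 := Ordinal n_gt0.
pose j0 := Ordinal (ltnW m_ge2).
pose s : R := m%:R - 1 - 2 * r%:R * (k%:R - 1).
have cE : c = (if (3 <= k)%N then 'C(m - 2, k - 3) else 0%N)%:R.
  by rewrite /c binz_pascal // natrD addrC addKr.
pose S0 : 'M[R]_n := \matrix_(i, j) seidel_entry R _ E0 i j.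
pose S j : 'M[R]_m := \matrix_(x, y) seidel_entry R _ (Es j) x y.
have id_bij N : bijective (@id 'I_N) by exists id.
have hS0 : char_poly S0 = \prod_i ('X - (mu0 i)%:P).
  by rewrite -hmu0 (char_poly_seidel _ _ _ _ _ (id_bij _)).
have hS j : char_poly (S j) = \prod_i ('X - (mus j i)%:P).
  by rewrite -hmus (char_poly_seidel _ _ _ _ _ (id_bij _)).
have S0T : S0^T = S0 by apply/matrixP=> i j; rewrite !mxE seidel_entryC.
pose M := \matrix_(s, t) seidel_entry R _ (corona_edges k E0 Es)
  (corona_index n m s) (corona_index n m t).
(* The four conditions are those of [det_corona_block] with e = 2c and f = 2b. *)
have generic x : h x != 0 -> h x + m%:R * n%:R != 0 -> s + 2 * c - x != 0 ->
    h x * mu0 i0 - (x * h x + m%:R * (2 * b) ^+ 2) != 0 ->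
    \det (M - x%:M) =
      ((mu0 i0 - x) * (h x + m%:R * n%:R) + 4 * b * m%:R * (n%:R - b) - m%:R * n%:R ^+ 2)
      * (\prod_(i < n | (0 < i)%N) (mu0 i * h x - 4 * m%:R * b ^+ 2 - x * h x))
      * (\prod_(j < n) \prod_(i < m | (0 < i)%N) (mus j i + 2 * c - x)).
  have hE : h x = s - m%:R - 2 * c * (m%:R - 1) - x by rewrite /h /s; ring.
  rewrite hE => h1 h2 h3 h4; rewrite corona_seidel_block -cE -binz_sub2.
  rewrite (det_corona_block _ _ _ S0 S mu0 mus i0 j0 s) //; first last.
  - by move=> j; apply: seidel_matrix_sum.
  - by rewrite hmu01; apply: seidel_matrix_sum.
  (* The first factors agree because m (n - 2b)^2 = m n^2 - 4 b m (n - b). *)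
  rewrite -/b; congr (_ * _ * _); first ring.
    by apply: eq_big => [i|i _]; [rewrite lt0n | ring].
  by apply: eq_bigr => j _; apply: eq_bigl => i; rewrite lt0n.
rewrite (det_seidel_sub_scalar _ _ _ _ (corona_index n m)); last exact: corona_index_bij.
(* [H], [P] and [Q] are h and the two sides of the formula as polynomials in mu. *)
pose C := 1 + 2 * r%:R * (k%:R - 1) + 2 * c * (m%:R - 1).
pose H : {poly R} := - (C%:P + 'X).
have HE x : H.[x] = h x by rewrite !hornerE.
pose P := \det (map_mx polyC M - 'X%:M).
have PE x : P.[x] = \det (M - x%:M).
  rewrite -[LHS]/(horner_eval x P) -det_map_mx; congr (\det _).
  apply/matrixP=> i j; rewrite !mxE /= horner_evalE hornerD hornerN hornerMn hornerX.
  by rewrite hornerC.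
pose Q : {poly R} :=
  (((mu0 i0)%:P - 'X) * (H + (m%:R * n%:R)%:P)
     + (4 * b * m%:R * (n%:R - b))%:P - (m%:R * n%:R ^+ 2)%:P)
  * (\prod_(i < n | (0 < i)%N) ((mu0 i)%:P * H - (4 * m%:R * b ^+ 2)%:P - 'X * H))
  * (\prod_(j < n) \prod_(i < m | (0 < i)%N) ((mus j i + 2 * c)%:P - 'X)).
have QE x : Q.[x] =
      ((mu0 i0 - x) * (h x + m%:R * n%:R) + 4 * b * m%:R * (n%:R - b) - m%:R * n%:R ^+ 2)
      * (\prod_(i < n | (0 < i)%N) (mu0 i * h x - 4 * m%:R * b ^+ 2 - x * h x))
      * (\prod_(j < n) \prod_(i < m | (0 < i)%N) (mus j i + 2 * c - x)).
  rewrite /Q !hornerM !horner_prod; congr (_ * _ * _).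
  - by rewrite !(hornerD, hornerN, hornerM, hornerC, hornerX, HE).
  - by apply: eq_bigr => i _; rewrite !(hornerD, hornerN, hornerM, hornerC, hornerX, HE).
  - apply: eq_bigr => j _; rewrite horner_prod; apply: eq_bigr => i _.
    by rewrite !(hornerD, hornerN, hornerC, hornerX).
rewrite -PE -QE; congr (_.[mu]).
(* The product of the four quantities required to be nonzero in [generic]. *)
pose D : {poly R} := H * (H + (m%:R * n%:R)%:P) * ((s + 2 * c)%:P - 'X)
  * (H * (mu0 i0)%:P - ('X * H + (m%:R * (2 * b) ^+ 2)%:P)).
apply: (poly_eq_generic _ _ _ D).
  have lin a : a%:P - 'X != 0 :> {poly R} by rewrite -opprB oppr_eq0 polyXsubC_eq0.
  rewrite !mulf_neq0 //.
  - by rewrite /H opprD -polyCN.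
  - have -> : H + (m%:R * n%:R)%:P = (m%:R * n%:R - C)%:P - 'X by rewrite /H polyCB; ring.
    exact: lin.
  (* As H = -(X + C), the last factor is (X - mu0(i0)) (X + C) - m (2b)^2. *)
  have := quadratic_neq0 _ (mu0 i0) (- C) (m%:R * (2 * b) ^+ 2).
  by congr (_ != 0); rewrite /H polyCN; ring.
move=> x Dx; rewrite PE QE; move: Dx.
rewrite /D !(hornerD, hornerN, hornerM, hornerC, hornerX, HE) !mulf_eq0 !negb_or.
case/andP=> /andP[/andP[h1 h2] h3] h4; exact: generic.
Qed.
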